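(* Let $P_{3,1}$ be the straight tromino (three unit squares in a $1\times3$ row) and $P_{3,2}$ the L-tromino (a $2\times2$ square with one unit square removed). Then $\tau(P_{3,1})=\tau(P_{3,2})=(1,7,\infty)$, i.e. each of them is a $(1,1)$-winner, a $(1,2)$-loser, a $(2,7)$-winner, a $(2,8)$-loser, and an $(n,b)$-winner for all $n\ge3$ and all $b\ge0$.
   Context: The board is the tiling of the plane by unit squares (cells); cells are adjacent if they share an edge. A polyomino is a finite connected set of cells up to congruence. In the weak $(a,b)$ achievement game ($a\ge1,b\ge0$) for a goal polyomino $A$ on the infinite board, maker and breaker alternately mark previously unmarked cells, maker first, $a$ resp. $b$ cells per turn; the maker wins if his marked cells at some point contain a set congruent to $A$; $A$ is an $(a,b)$-winner if the maker has a strategy guaranteeing a win in finitely many turns against every breaker play, otherwise an $(a,b)$-loser. The threshold sequence $\tau(A)=(b_1,b_2,\ldots)$ has $b_n$ the greatest $b$ for which $A$ is an $(n,b)$-winner ($\infty$ if for all $b$); $(b_1,\ldots,b_{k-1},\infty)$ denotes the sequence with $b_n=\infty$ for all $n\ge k$. *)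

(* Defs.v *)
From HB Require Import structures.
From mathcomp Require Import all_boot all_order all_algebra finmap.

Set Implicit Arguments.
Unset Strict Implicit.
Unset Printing Implicit Defensive.

Import Order.TTheory GRing.Theory Num.Theory.
Local Open Scope fset_scope.
Local Open Scope ring_scope.

(* [(i, j)] stands for the unit square [i, i+1] x [j, j+1]. *)
Notation cell := (int * int)%type.

Definition adjacent : rel cell :=
  [rel x y : cell | `|x.1 - y.1| + `|x.2 - y.2| == 1].

Definition connected (A : {fset cell}) : Prop :=
  forall x y : cell, x \in A -> y \in A ->
    exists p : seq cell,
      [/\ path adjacent x p, last x p = y & {subset p <= A}].

(* A representative of the congruence class; the game below depends on the goal
   only through the sets congruent to it. *)
Record polyomino := Polyomino {
  polyomino_cells :> {fset cell};
  polyomino_connected : connected polyomino_cells }.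

Definition sqdist (x y : cell) : int :=
  (x.1 - y.1) ^+ 2 + (x.2 - y.2) ^+ 2.

(* Centres of cells form a translate of Z^2, so the isometries of the plane that
   preserve the board are exactly the distance-preserving maps on cells. *)
Definition isometry (f : cell -> cell) : Prop :=
  forall x y : cell, sqdist (f x) (f y) = sqdist x y.

Definition congruent (A B : {fset cell}) : Prop :=
  exists2 f : cell -> cell, isometry f & B = [fset f x | x in A].

(* A maker strategy gives the maker's next move from the list, in chronological
   order, of the breaker's moves so far (the maker's own earlier moves are then
   determined).  In each round, numbered from 0, the maker moves first. *)
Definition strategy : Type := seq {fset cell} -> {fset cell}.
Definition breaker_play : Type := nat -> {fset cell}.

Section Play.

Variables (s : strategy) (p : breaker_play).

Definition maker_move (n : nat) : {fset cell} := s (mkseq p n).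

Definition maker_marks (n : nat) : {fset cell} :=
  (\bigcup_(i <- iota 0 n) maker_move i)%fset.

Definition breaker_marks (n : nat) : {fset cell} :=
  (\bigcup_(i <- iota 0 n) p i)%fset.

Definition legal_maker_move (a n : nat) : Prop :=
  #|` maker_move n| = a /\
  [disjoint maker_move n & maker_marks n `|` breaker_marks n]%fset.

Definition legal_breaker_move (b n : nat) : Prop :=
  #|` p n| = b /\
  [disjoint p n & maker_marks n.+1 `|` breaker_marks n]%fset.

Definition maker_achieves (A : polyomino) (n : nat) : Prop :=
  exists2 C : {fset cell}, congruent A C & C `<=` maker_marks n.

End Play.

(* The play is prolonged after a win; on an infinite board this is always
   possible and has no effect on the outcome. *)
Definition winner (a b : nat) (A : polyomino) : Prop :=
  exists s : strategy, forall p : breaker_play,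
    (forall n, legal_breaker_move s p b n) ->
    (forall n, legal_maker_move s p a n) /\
    (exists n, maker_achieves s p A n).

Definition loser (a b : nat) (A : polyomino) : Prop := ~ winner a b A.

Variant threshold := Finite of nat | Infinite.

Definition is_threshold (A : polyomino) (n : nat) (t : threshold) : Prop :=
  match t with
  | Finite b =>
      winner n b A /\ (forall b' : nat, winner n b' A -> (b' <= b)%N)
  | Infinite => forall b : nat, winner n b A
  end.

Lemma is_threshold_unique (A : polyomino) (n : nat) (t u : threshold) :
  is_threshold A n t -> is_threshold A n u -> t = u.
Proof.
case: t u => [b|] [c|] //=.
- move=> [wb bmax] [wc cmax]; congr Finite; apply/eqP.
  by rewrite eqn_leq cmax // bmax.
- by move=> [_ bmax] /(_ b.+1)/bmax; rewrite ltnn.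
- by move=> winf [_ /(_ _ (winf c.+1))]; rewrite ltnn.
Qed.

(* Sequences are indexed from 1. *)
Definition is_threshold_sequence (A : polyomino) (t : nat -> threshold) : Prop :=
  forall n : nat, (1 <= n)%N -> is_threshold A n (t n).

(* (b_1, ..., b_{k-1}, infinity) *)
Definition then_infinite (bs : seq nat) (n : nat) : threshold :=
  nth Infinite (map Finite bs) n.-1.

Definition straight_tromino_cells : {fset cell} :=
  [fset ((0, 0) : cell); ((1, 0) : cell); ((2, 0) : cell)].

Definition L_tromino_cells : {fset cell} :=
  [fset ((0, 0) : cell); ((1, 0) : cell); ((0, 1) : cell)].

Lemma connected_tromino (x y z : cell) :
  adjacent x y -> adjacent y x -> adjacent x z -> adjacent z x ->
  connected [fset y; x; z].
Proof.
move=> xy yx xz zx u v; rewrite !inE -!orbA.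
have sub p : all [in [:: y; x; z]] p -> {subset p <= [fset y; x; z]}.
  by move=> /allP h w /h; rewrite !inE -!orbA.
have K p : path adjacent u p -> last u p = v ->
    all [in [:: y; x; z]] p -> exists p : seq cell,
      [/\ path adjacent u p, last u p = v & {subset p <= [fset y; x; z]}].
  by move=> h1 h2 h3; exists p; split=> //; apply: sub.
move=> /or3P[]/eqP eu /or3P[]/eqP ev; subst u v;
  [ apply: (K [::]) | apply: (K [:: x]) | apply: (K [:: x; z])
  | apply: (K [:: y]) | apply: (K [::]) | apply: (K [:: z])
  | apply: (K [:: x; y]) | apply: (K [:: x]) | apply: (K [::]) ] => //=;
  by rewrite ?xy ?yx ?xz ?zx ?inE ?eqxx ?orbT.
Qed.

Lemma straight_tromino_connected : connected straight_tromino_cells.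
Proof. exact: connected_tromino. Qed.

Lemma L_tromino_connected : connected L_tromino_cells.
Proof.
rewrite /L_tromino_cells [X in X `|` _]fsetUC; exact: connected_tromino.
Qed.

Definition P31 : polyomino := Polyomino straight_tromino_connected.
Definition P32 : polyomino := Polyomino L_tromino_connected.

(* Main.v *)
Require Import Defs.
From mathcomp Require Import all_boot all_order all_algebra finmap boolp zify ring.

(* The breaker fixes a symmetric relation on cells and always marks all free
   relatives of the cells just marked, so that related maker cells come from a
   single turn.  With two maker cells per turn, edge adjacency (degree 4, hence 8
   breaker cells) blocks both trominoes, since one cell of a tromino is adjacent
   to the other two.  With one maker cell per turn it suffices that every tromino
   contains a related pair, and degree 2 is enough: domino mates for the straight
   tromino, horizontal neighbours for the L.  The maker wins by creating more
   pairwise disjoint threats than the breaker has marks. *)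

Set Implicit Arguments.
Unset Strict Implicit.
Unset Printing Implicit Defensive.

Import Order.TTheory GRing.Theory Num.Theory.

Section Trominoes.

Local Open Scope fset_scope.
Local Open Scope ring_scope.

(** * Finite sets of cells *)

Lemma exists_fresh_cell (U : {fset cell}) : exists x : cell, x \notin U.
Proof.
apply: contrapT => noU.
pose f (n : nat) : cell := (n%:Z, 0).
have f_inj : injective f by move=> m n [].
have sub : [fset x in map f (iota 0 #|` U|.+1)] `<=` U.
  apply/fsubsetP => x _; apply/negPn/negP => xU; by apply: noU; exists x.
have := fsubset_leq_card sub.
rewrite card_fseq undup_id ?map_inj_uniq ?iota_uniq //.
by rewrite size_map size_iota ltnn.
Qed.

(** A legal move has exactly the prescribed size, so a move whose essential part is smaller is
    padded with arbitrary free cells. *)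
Lemma extend_to_card (U Y : {fset cell}) (b : nat) :
  (#|` Y| <= b)%N -> [disjoint Y & U]%fset ->
  exists Z : {fset cell},
    [/\ Y `<=` Z, #|` Z| = b & [disjoint Z & U]%fset].
Proof.
move=> leYb dY; elim: b leYb => [|b IH].
  by rewrite leqn0 => /eqP cY; exists Y.
rewrite leq_eqVlt => /orP[/eqP cY|/IH[Z [YZ cZ dZ]]]; first by exists Y.
have [x] := exists_fresh_cell (Z `|` U); rewrite inE negb_or => /andP[xZ xU].
exists (x |` Z); split; first by rewrite fsubsetU // YZ orbT.
  by rewrite cardfsU1 xZ cZ.
by rewrite fdisjointU1X xU.
Qed.

Lemma exists_fresh_fset (U : {fset cell}) (b : nat) :
  exists2 Z : {fset cell}, #|` Z| = b & [disjoint Z & U]%fset.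
Proof.
have [|Z [_ cZ dZ]] := @extend_to_card U fset0 b _ (fdisjoint0X _).
  by rewrite cardfs0.
by exists Z.
Qed.

(** Pigeonhole: the blocks are disjoint, so a cell of [Y] spoils at most one of them. In the
    induction, the cell that spoils the first block is dropped from [Y]. *)
Lemma exists_missed_block (ps : seq (seq cell)) (Y : {fset cell}) :
  uniq (flatten ps) -> (#|` Y| < size ps)%N ->
  exists2 q, q \in ps & all [predC Y] q.
Proof.
elim: ps Y => [|q ps IH] Y //=; rewrite cat_uniq => /and3P[_ dq ups] ltY.
have [qY|] := boolP (all [predC Y] q); first by exists q; rewrite ?mem_head.
case/allPn => y yq; rewrite inE negbK => yY.
have [|r rps rY] := IH (Y `\ y) ups.
  by move: ltY; rewrite (cardfsD1 y Y) yY.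
exists r; first by rewrite inE rps orbT.
apply/allP => z zr; move/allP: rY => /(_ z zr) /=; rewrite !inE negb_and negbK.
case/orP => // /eqP zy; case/hasP: dq; exists y => //.
by rewrite -zy; apply/flattenP; exists r.
Qed.

(** * From strategies to positions *)

Lemma mkseqS (T : Type) (p : nat -> T) (n : nat) :
  mkseq p n.+1 = rcons (mkseq p n) (p n).
Proof. by rewrite /mkseq -addn1 iotaD map_cat /= cats1. Qed.

Lemma maker_marksS (s : strategy) (p : breaker_play) (n : nat) :
  maker_marks s p n.+1 = maker_marks s p n `|` maker_move s p n.
Proof. by rewrite /maker_marks -addn1 iotaD big_cat big_seq1. Qed.

Lemma breaker_marksS (p : breaker_play) (n : nat) :
  breaker_marks p n.+1 = breaker_marks p n `|` p n.
Proof. by rewrite /breaker_marks -addn1 iotaD big_cat big_seq1. Qed.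

Lemma maker_marks0 (s : strategy) (p : breaker_play) :
  maker_marks s p 0 = fset0.
Proof. by rewrite /maker_marks big_nil. Qed.

Lemma breaker_marks0 (p : breaker_play) : breaker_marks p 0 = fset0.
Proof. by rewrite /breaker_marks big_nil. Qed.

Definition legal_mark (c : nat) (X U : {fset cell}) : Prop :=
  #|` X| = c /\ [disjoint X & U]%fset.

Definition contains_copy (A M : {fset cell}) : Prop :=
  exists2 C : {fset cell}, congruent A C & C `<=` M.

(* [M] and [B] are the cells marked so far; the maker, to move, can force a
   copy of [A] within [k] further moves. *)
Fixpoint wins (a b : nat) (A : {fset cell}) (k : nat) (M B : {fset cell}) :
    Prop :=
  if k is k'.+1 then
    exists2 X, legal_mark a X (M `|` B) &
      forall Y, legal_mark b Y ((M `|` X) `|` B) ->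
        wins a b A k' (M `|` X) (B `|` Y)
  else contains_copy A M.

(** Choice turns the nested quantifiers of [wins] into a map [g] from positions with a countdown to
    moves; folding over the breaker's history recovers the current position. *)
Lemma winner_of_wins (a b k : nat) (A : polyomino) :
  wins a b A k fset0 fset0 -> winner a b A.
Proof.
move=> win0.
pose good (t : nat * {fset cell} * {fset cell}) X :=
  legal_mark a X (t.1.2 `|` t.2) /\
  ((0 < t.1.1)%N -> wins a b A t.1.1 t.1.2 t.2 -> forall Y,
    legal_mark b Y ((t.1.2 `|` X) `|` t.2) ->
    wins a b A t.1.1.-1 (t.1.2 `|` X) (t.2 `|` Y)).
have /choice[g gP] : forall t, exists X, good t X.
  case=> [[j M] B]; rewrite /good /=.
  (* Fallback for lost positions and for countdown 0: the maker must move legally even after his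
     win. *)
  have fresh : exists X, legal_mark a X (M `|` B).
    by have [X cX dX] := exists_fresh_fset (M `|` B) a; exists X.
  case: j => [|j] /=; first by have [X lX] := fresh; exists X.
  have [[X lX wX]|nwin] := pselect (wins a b A j.+1 M B).
    by exists X; split.
  by have [X lX] := fresh; exists X; split=> // _ /nwin.
pose step (t : nat * {fset cell} * {fset cell}) Y :=
  (t.1.1.-1, t.1.2 `|` g t, t.2 `|` Y).
pose st := foldl step (k, fset0, fset0).
exists (fun h => g (st h)) => p legp; set s := (fun h => _) in legp *.
have stE n : st (mkseq p n) = ((k - n)%N, maker_marks s p n, breaker_marks p n).
  elim: n => [|n IH].
    by rewrite /st /= maker_marks0 breaker_marks0 subn0.
  rewrite mkseqS /st foldl_rcons -/(st _) {1}/step maker_marksS breaker_marksS.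
  by rewrite /maker_move /s IH /= subnS.
have gE n : maker_move s p n =
    g ((k - n)%N, maker_marks s p n, breaker_marks p n).
  by rewrite /maker_move /s stE.
split=> [n|].
  rewrite /legal_maker_move gE.
  by case: (gP ((k - n)%N, maker_marks s p n, breaker_marks p n)) => [[]].
exists k.
suff inv n : (n <= k)%N ->
    wins a b A (k - n)%N (maker_marks s p n) (breaker_marks p n).
  by have := inv k (leqnn k); rewrite subnn.
elim: n => [|n IH] lenk; first by rewrite subn0 maker_marks0 breaker_marks0.
rewrite maker_marksS breaker_marksS gE subnS.
have [_] := gP ((k - n)%N, maker_marks s p n, breaker_marks p n).
move=> /= h; apply: h; first by rewrite subn_gt0.
  exact/IH/ltnW.
by have := legp n; rewrite /legal_breaker_move maker_marksS gE.
Qed.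

Lemma wins_last_move (a b : nat) (A C M B : {fset cell}) :
  congruent A C -> (#|` C `\` M| <= a)%N -> [disjoint C & B]%fset ->
  wins a b A 1 M B.
Proof.
move=> cong cC dC /=.
have [|Z [CZ cZ dZ]] := @extend_to_card (M `|` B) _ _ cC.
  apply/fdisjointP => x; rewrite !inE => /andP[xM xC].
  by rewrite negb_or xM (fdisjointP dC).
exists Z => // Y _; exists C => //.
apply/fsubsetP => x xC; rewrite inE; case: (boolP (x \in M)) => //= xM.
by apply: (fsubsetP CZ); rewrite inE xM.
Qed.

(** Against a fixed maker strategy [s], the breaker's play is built by recursion on rounds, carrying
    his own history because [s] reads it. *)
Lemma loser_of_invariant (a b : nat) (A : polyomino)
    (I : {fset cell} -> {fset cell} -> Prop) :
  I fset0 fset0 ->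
  (forall M B, I M B -> ~ contains_copy A M) ->
  (forall M B X, I M B -> legal_mark a X (M `|` B) ->
    exists2 Y, legal_mark b Y ((M `|` X) `|` B) & I (M `|` X) (B `|` Y)) ->
  loser a b A.
Proof.
move=> I0 Ino Istep [s sP].
pose good (t : {fset cell} * {fset cell} * {fset cell}) Y :=
  legal_mark b Y ((t.1.1 `|` t.2) `|` t.1.2) /\
  (I t.1.1 t.1.2 -> legal_mark a t.2 (t.1.1 `|` t.1.2) ->
    I (t.1.1 `|` t.2) (t.1.2 `|` Y)).
have /choice[r rP] : forall t, exists Y, good t Y.
  case=> [[M B] X]; rewrite /good /=.
  have [[iMB lX]|nI] := pselect (I M B /\ legal_mark a X (M `|` B)).
    by have [Y lY iY] := Istep _ _ _ iMB lX; exists Y; split.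
  have [Y cY dY] := exists_fresh_fset ((M `|` X) `|` B) b.
  by exists Y; split=> // iMB lX; case: nI.
pose resp (t : seq {fset cell} * {fset cell} * {fset cell}) :=
  r (t.1.2, t.2, s t.1.1).
pose step (t : seq {fset cell} * {fset cell} * {fset cell}) :=
  (rcons t.1.1 (resp t), t.1.2 `|` s t.1.1, t.2 `|` resp t).
pose st n := iter n step ([::], fset0, fset0).
pose p n := resp (st n).
have stE n : st n = (mkseq p n, maker_marks s p n, breaker_marks p n).
  elim: n => [|n IH]; first by rewrite maker_marks0 breaker_marks0.
  rewrite mkseqS maker_marksS breaker_marksS /maker_move.
  by rewrite {1}/st iterS -/(st n) /step -/(p n) IH.
have pE n : p n = r (maker_marks s p n, breaker_marks p n, maker_move s p n).
  by rewrite /p /resp stE.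
have legp n : legal_breaker_move s p b n.
  rewrite /legal_breaker_move maker_marksS pE.
  by case: (rP (maker_marks s p n, breaker_marks p n, maker_move s p n)).
have [legs [n win]] := sP p legp.
suff inv m : I (maker_marks s p m) (breaker_marks p m) by exact: Ino (inv n) win.
elim: m => [|m IH]; first by rewrite maker_marks0 breaker_marks0.
rewrite maker_marksS breaker_marksS pE.
case: (rP (maker_marks s p m, breaker_marks p m, maker_move s p m)) => _.
by apply=> //; exact: legs.
Qed.

(** * The breaker closes stars *)

Lemma card_bigfcup_le (T : cell -> {fset cell}) (d : nat) (X : {fset cell}) :
  (forall x, #|` T x| <= d)%N ->
  (#|` \bigcup_(x <- X) T x| <= #|` X| * d)%N.
Proof.
move=> cT; elim: (X : seq cell) => [|x l IH]; first by rewrite big_nil cardfs0.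
rewrite big_cons mulSn; apply: leq_trans (leq_card_fsetU _ _).1 _.
exact: leq_add.
Qed.

(* Whenever the maker marks [X], the breaker marks every free cell of [T x] for
   [x] in [X].  The maker can thus never mark a [T]-neighbour of one of his
   older cells, so all his cells in a [T]-star were marked in a single turn. *)
Lemma star_loser (a b d : nat) (A : polyomino) (T : cell -> {fset cell}) :
  (forall x y, y \in T x -> x \in T y) ->
  (forall x, #|` T x| <= d)%N -> (a * d <= b)%N ->
  (forall C, congruent A C ->
    exists2 c, c \in C & (a < #|` C `&` (c |` T c)|)%N) ->
  loser a b A.
Proof.
move=> Tsym cT adb cov.
pose I (M B : {fset cell}) :=
  (forall x, x \in M -> T x `<=` M `|` B) /\
  (forall x, x \in M -> #|` M `&` (x |` T x)| <= a)%N.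
apply: (@loser_of_invariant _ _ _ I).
- by split=> x; rewrite inE.
- move=> M B [_ small] [C congC CM].
  have [c cC] := cov C congC; rewrite ltnNge => /negP; apply.
  apply: leq_trans (small c (fsubsetP CM _ cC)).
  exact/fsubset_leq_card/fsetSI.
move=> M B X [closed small] [cX dX].
pose Y0 := (\bigcup_(x <- X) T x) `\` ((M `|` X) `|` B).
have dY0 : [disjoint Y0 & (M `|` X) `|` B]%fset.
  by apply/fdisjointP => y; rewrite in_fsetD => /andP[].
have [|Y [Y0Y cY dY]] := @extend_to_card ((M `|` X) `|` B) Y0 b _ dY0.
  apply: leq_trans adb; rewrite -cX; apply: leq_trans (card_bigfcup_le X cT).
  exact/fsubset_leq_card/fsubsetDl.
exists Y => //; split=> x; rewrite inE => /orP[xM|xX].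
- apply: fsubset_trans (closed x xM) _.
  by apply: fsetUSS; apply: fsubsetUl.
- apply/fsubsetP => y yT.
  case: (boolP (y \in (M `|` X) `|` B)) => [|yn].
    by rewrite !inE => /orP[->|->]; rewrite ?orbT.
  have /(fsubsetP Y0Y) yY : y \in Y0.
    by rewrite inE yn; apply/bigfcupP; exists x; rewrite ?xX.
  by rewrite !inE yY !orbT.
- apply: leq_trans (small x xM); apply/fsubset_leq_card/fsubsetP => y.
  rewrite !in_fsetI => /andP[yMX yst]; rewrite yst andbT.
  move: yMX; rewrite in_fsetU => /orP[//|yX].
  have yMB : y \notin M `|` B by apply: (fdisjointP dX).
  move: yst; rewrite in_fset1U => /orP[/eqP->//|yT].
  by rewrite (fsubsetP (closed x xM) _ yT) in yMB.
(* A new centre [x] has no older [T]-neighbour [y]: by symmetry [x] would lie in [T y], which is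
   already fully marked. *)
- rewrite -cX; apply/fsubset_leq_card/fsubsetP => y.
  rewrite in_fsetI in_fset1U in_fsetU => /andP[/orP[yM|//]] /orP[/eqP->//|yT].
  have := fdisjointP dX x xX.
  by rewrite (fsubsetP (closed y yM) _ (Tsym _ _ yT)).
Qed.

(** * Copies of the trominoes *)

(** With cells read as Gaussian integers, this is [c + u * x]; a unit [u] makes it a rotation
    followed by a translation. *)
Definition frame (c u : cell) (x : cell) : cell :=
  (c.1 + x.1 * u.1 - x.2 * u.2, c.2 + x.1 * u.2 + x.2 * u.1).

Lemma frame_isometry (c u : cell) :
  u.1 ^+ 2 + u.2 ^+ 2 = 1 -> Defs.isometry (frame c u).
Proof.
move=> u1 x y; rewrite /sqdist /frame /= -[RHS]mul1r -u1; ring.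
Qed.

Lemma imfset3 (f : cell -> cell) (x y z : cell) :
  [fset f t | t in [fset x; y; z]] = [fset f x; f y; f z].
Proof.
apply/fsetP => t; apply/imfsetP/idP => [[w /=]|].
  by rewrite !inE => /orP[/orP[]|] /eqP-> ->; rewrite eqxx ?orbT.
by rewrite !inE => /orP[/orP[]|] /eqP->; [exists x|exists y|exists z];
  rewrite ?inE ?eqxx ?orbT.
Qed.

Lemma straight_copy (c u : cell) : u.1 ^+ 2 + u.2 ^+ 2 = 1 ->
  congruent P31 [fset c; (c.1 + u.1, c.2 + u.2); (c.1 + 2 * u.1, c.2 + 2 * u.2)].
Proof.
move=> u1; exists (frame c u); first exact: frame_isometry.
rewrite /= /straight_tromino_cells imfset3 /frame /=.
by rewrite !(mul0r, mul1r, subr0, addr0) -surjective_pairing.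
Qed.

Lemma L_copy (c u : cell) : u.1 ^+ 2 + u.2 ^+ 2 = 1 ->
  congruent P32 [fset c; (c.1 + u.1, c.2 + u.2); (c.1 - u.2, c.2 + u.1)].
Proof.
move=> u1; exists (frame c u); first exact: frame_isometry.
rewrite /= /L_tromino_cells imfset3 /frame /=.
by rewrite !(mul0r, mul1r, subr0, addr0) -surjective_pairing.
Qed.

Definition neighbours (x : cell) : {fset cell} :=
  [fset y in [:: (x.1 + 1, x.2); (x.1 - 1, x.2); (x.1, x.2 + 1);
                 (x.1, x.2 - 1)]].

Lemma card_fset_seq_le (s : seq cell) : (#|` [fset x in s]| <= size s)%N.
Proof. by rewrite card_fseq size_undup. Qed.

Lemma neighbours_sym (x y : cell) : y \in neighbours x -> x \in neighbours y.
Proof.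
case: x y => [x1 x2] [y1 y2]; rewrite !inE /= !xpair_eqE; lia.
Qed.

Lemma sqdist1_neighbours (x y : cell) : sqdist x y = 1 -> y \in neighbours x.
Proof.
case: x y => [x1 x2] [y1 y2]; rewrite /sqdist !inE /= !xpair_eqE.
set u := x1 - y1; set v := x2 - y2 => uv.
have [u1 v1] : (-1 <= u <= 1) /\ (-1 <= v <= 1) by split; nia.
have : [|| u == -1, u == 0 | u == 1] by lia.
have : [|| v == -1, v == 0 | v == 1] by lia.
by case/or3P=> /eqP v0 /or3P[]/eqP u0; move: uv; rewrite u0 v0 // => _; lia.
Qed.

(** Distances are all that the breaker's side needs: for two neighbours of [c], squared distance 4
    means opposite sides, and 2 means perpendicular sides. *)
Lemma straight_copyP (C : {fset cell}) : congruent P31 C ->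
  exists c x y, [/\ C = [fset x; c; y], sqdist c x = 1, sqdist c y = 1 &
    sqdist x y = 4].
Proof.
case=> f fI; rewrite /= /straight_tromino_cells imfset3 => ->.
by exists (f (1, 0)), (f (0, 0)), (f (2, 0)); rewrite !fI.
Qed.

Lemma L_copyP (C : {fset cell}) : congruent P32 C ->
  exists c x y, [/\ C = [fset c; x; y], sqdist c x = 1, sqdist c y = 1 &
    sqdist x y = 2].
Proof.
case=> f fI; rewrite /= /L_tromino_cells imfset3 => ->.
by exists (f (0, 0)), (f (1, 0)), (f (0, 1)); rewrite !fI.
Qed.

Lemma card_fset3 (x y z : cell) :
  x != y -> x != z -> y != z -> #|` [fset x; y; z]| = 3%N.
Proof.
move=> xy xz yz.
by rewrite -fsetUA cardfsU1 cardfs2 !inE negb_or xy xz yz.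
Qed.

Lemma sqdistxx (x : cell) : sqdist x x = 0.
Proof. by rewrite /sqdist !subrr. Qed.

Lemma sqdist_neq (x y : cell) : sqdist x y != 0 -> x != y.
Proof. by apply: contraNneq => ->; rewrite sqdistxx. Qed.

Lemma tromino_star (C : {fset cell}) (c x y : cell) :
  C = [fset c; x; y] -> sqdist c x = 1 -> sqdist c y = 1 ->
  sqdist x y != 0 ->
  exists2 c, c \in C & (2 < #|` C `&` (c |` neighbours c)|)%N.
Proof.
move=> -> cx cy xy; exists c; first by rewrite !inE eqxx.
have -> : [fset c; x; y] `&` (c |` neighbours c) = [fset c; x; y].
  apply/fsetIidPl; rewrite !fsubUset !fsub1set !in_fset1U eqxx.
  by rewrite (sqdist1_neighbours cx) (sqdist1_neighbours cy) !orbT.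
by rewrite card_fset3 ?sqdist_neq ?cx ?cy.
Qed.

Lemma edge_star (T : cell -> {fset cell}) (C : {fset cell}) (c d : cell) :
  c \in C -> d \in C -> c != d -> d \in T c ->
  exists2 c, c \in C & (1 < #|` C `&` (c |` T c)|)%N.
Proof.
move=> cC dC cd dT; exists c => //.
have -> : 2%N = #|` [fset c; d]| by rewrite cardfs2 cd.
apply/fsubset_leq_card/fsubsetP => x; rewrite in_fsetI in_fset1U !inE.
by case/orP=> /eqP->; rewrite ?cC ?dC ?dT ?eqxx ?orbT.
Qed.

(** * The breaker's cases *)

Lemma tromino_loser_2 (A : polyomino) (b : nat) :
  A = P31 \/ A = P32 -> (8 <= b)%N -> loser 2 b A.
Proof.
move=> AP b8; apply: (@star_loser _ _ 4 _ neighbours) => //.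
- exact: neighbours_sym.
- by move=> x; apply: leq_trans (card_fset_seq_le _) _.
case: AP => -> C.
  case/straight_copyP=> c [x [y [-> cx cy xy]]].
  by apply: (@tromino_star _ c x y); rewrite ?xy // [X in X `|` _]fsetUC.
case/L_copyP=> c [x [y [-> cx cy xy]]].
by apply: (@tromino_star _ c x y); rewrite ?xy.
Qed.

(** The involution that swaps [2k] and [2k + 1]. *)
Definition domino_mate (i : int) : int := i + 1 - 2 * (i %% 2)%Z.

(* Rows and columns are cut into dominoes; the middle cell of a straight tromino
   always has one of the two ends as a mate. *)
Definition domino_mates (x : cell) : {fset cell} :=
  [fset y in [:: (domino_mate x.1, x.2); (x.1, domino_mate x.2)]].

Definition row_neighbours (x : cell) : {fset cell} :=
  [fset y in [:: (x.1 + 1, x.2); (x.1 - 1, x.2)]].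

Lemma straight_loser_1 (b : nat) : (2 <= b)%N -> loser 1 b P31.
Proof.
move=> b2; apply: (@star_loser _ _ 2 _ domino_mates) => //.
- move=> [x1 x2] [y1 y2]; rewrite /domino_mates /domino_mate !inE /=.
  rewrite !xpair_eqE; lia.
- by move=> x; apply: leq_trans (card_fset_seq_le _) _.
move=> C /straight_copyP[[c1 c2] [x [y [-> cx cy xy]]]].
have [xN yN] := (sqdist1_neighbours cx, sqdist1_neighbours cy).
have : [|| x \in domino_mates (c1, c2) | y \in domino_mates (c1, c2)].
  case: x y xN yN xy {cx cy} => [x1 x2] [y1 y2].
  rewrite /domino_mates /domino_mate !inE /sqdist /= !xpair_eqE !orbF.
  (* Only opposite positions of the ends survive the distance condition; parity then decides which
     end is the mate. *)
  by case/or4P=> /andP[/eqP-> /eqP->] /or4P[]/andP[/eqP-> /eqP->] xy; lia.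
case/orP=> [xT|yT].
  by apply: edge_star xT; rewrite ?sqdist_neq ?cx ?inE ?eqxx ?orbT.
by apply: edge_star yT; rewrite ?sqdist_neq ?cy ?inE ?eqxx ?orbT.
Qed.

(** The arms at the corner of an L are perpendicular, so exactly one of them is horizontal. *)
Lemma L_loser_1 (b : nat) : (2 <= b)%N -> loser 1 b P32.
Proof.
move=> b2; apply: (@star_loser _ _ 2 _ row_neighbours) => //.
- move=> [x1 x2] [y1 y2]; rewrite !inE /= !xpair_eqE; lia.
- by move=> x; apply: leq_trans (card_fset_seq_le _) _.
move=> C /L_copyP[[c1 c2] [x [y [-> cx cy xy]]]].
have [xN yN] := (sqdist1_neighbours cx, sqdist1_neighbours cy).
have : [|| x \in row_neighbours (c1, c2) | y \in row_neighbours (c1, c2)].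
  case: x y xN yN xy {cx cy} => [x1 x2] [y1 y2].
  rewrite !inE /sqdist /= !xpair_eqE !orbF.
  by case/or4P=> /andP[/eqP-> /eqP->] /or4P[]/andP[/eqP-> /eqP->] xy; lia.
case/orP=> [xT|yT].
  by apply: edge_star xT; rewrite ?sqdist_neq ?cx ?inE ?eqxx ?orbT.
by apply: edge_star yT; rewrite ?sqdist_neq ?cy ?inE ?eqxx ?orbT.
Qed.

(** * The maker's cases *)

Lemma wins_from_one_cell (b : nat) (A M B : {fset cell}) (x y z : cell) :
  congruent A [fset x; y; z] -> x \in M ->
  x \notin B -> y \notin B -> z \notin B -> wins 2 b A 1 M B.
Proof.
move=> cong xM xB yB zB; apply: wins_last_move cong _ _.
  apply: leq_trans (_ : #|` [fset y; z]| <= 2)%N; last first.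
    by rewrite cardfs2; case: eqP.
  apply/fsubset_leq_card/fsubsetP => t; rewrite !inE -orbA => /andP[tM].
  by case/orP=> // /eqP tx; rewrite tx xM in tM.
by apply/fdisjointP => t; rewrite !inE => /orP[/orP[]|] /eqP->.
Qed.

Lemma wins_from_two_cells (b : nat) (A M B : {fset cell}) (x y z : cell) :
  congruent A [fset x; y; z] -> x \in M -> y \in M ->
  x \notin B -> y \notin B -> z \notin B -> wins 1 b A 1 M B.
Proof.
move=> cong xM yM xB yB zB; apply: wins_last_move cong _ _.
  apply: leq_trans (_ : #|` [fset z]| <= 1)%N; last by rewrite cardfs1.
  apply/fsubset_leq_card/fsubsetP => t; rewrite !inE => /andP[tM].
  by case/orP=> // /orP[]/eqP tx; rewrite tx ?xM ?yM in tM.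
by apply/fdisjointP => t; rewrite !inE => /orP[/orP[]|] /eqP->.
Qed.

(** Threats reach at most two cells from their centre in each coordinate, so distance 10 keeps the
    two groups apart. *)
Definition far_cells : seq cell := [:: (0, 0); (10, 0)].

Definition directions : seq cell := [:: (1, 0); (0, 1); (-1, 0); (0, -1)].

Lemma directions_unit (u : cell) : u \in directions -> u.1 ^+ 2 + u.2 ^+ 2 = 1.
Proof. by rewrite !inE => /or4P[]/eqP->. Qed.

(* After marking two distant cells the maker threatens to complete eight copies
   with pairwise disjoint missing pairs, and seven marks cannot meet them all. *)
Lemma winner_2_7 (A : polyomino) (y z : cell -> cell -> cell) :
  (forall c u, u \in directions -> congruent A [fset c; y c u; z c u]) ->
  uniq (flatten [seq [:: y c u; z c u] | c <- far_cells, u <- directions]) ->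
  winner 2 7 A.
Proof.
move=> copy disj; apply: (@winner_of_wins _ _ 2).
exists [fset x in far_cells].
  by split; rewrite ?card_fseq // fsetU0 fdisjointX0.
move=> Y [cY dY]; rewrite !fset0U in dY *.
have [|q] := exists_missed_block (Y := Y) disj; first by rewrite cY.
case/allpairsP=> [[c u] [/= cf ud ->]] /and3P[/= yY zY _].
apply: (@wins_from_one_cell _ _ _ _ c _ _ (copy c u ud)) => //.
  by rewrite in_fset.
apply/negP => cY'; have := fdisjointP dY c cY'.
by rewrite fsetU0 in_fset cf.
Qed.

(* The maker's second cell [y u] creates the two threats [z u] and [w u]. *)
Lemma winner_1_1 (A : polyomino) (us : seq cell) (y z w : cell -> cell) :
  (1 < size us)%N ->
  (forall u, u \in us -> congruent A [fset (0, 0); y u; z u]) ->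
  (forall u, u \in us -> congruent A [fset (0, 0); y u; w u]) ->
  (forall u, u \in us -> z u != w u) ->
  uniq ((0, 0) :: flatten [seq [:: y u; z u; w u] | u <- us]) ->
  winner 1 1 A.
Proof.
move=> us2 copyz copyw zw /andP[/flattenP n0 disj]; apply: (@winner_of_wins _ _ 3).
exists [fset (0, 0)]; first by split; rewrite ?cardfs1 // fsetU0 fdisjointX0.
move=> Y [cY dY]; rewrite !fset0U fsetU0 in dY *.
have Y0 : (0, 0) \notin Y by rewrite -fdisjointX1.
(* One mark spoils at most one of the at least two blocks, so some [u] keeps all three of its cells
   free. *)
have [|q] := exists_missed_block (Y := Y) disj; first by rewrite cY size_map.
case/mapP=> u uus ->; rewrite /= andbT => /and3P[yY zY wY].
have y0 : y u != (0, 0).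
  apply/eqP => yu0; case: n0; exists [:: y u; z u; w u].
    by apply/mapP; exists u.
  by rewrite yu0 mem_head.
exists [fset y u].
  by split; rewrite ?cardfs1 // fdisjoint1X !inE negb_or y0.
move=> Y' [cY' dY'].
have [M0 My] : (0, 0) \in [fset (0, 0); y u] /\ y u \in [fset (0, 0); y u].
  by rewrite !inE !eqxx orbT.
have [Y0' yY'] : (0, 0) \notin Y' /\ y u \notin Y'.
  by split; apply/negP => /(fdisjointP dY'); rewrite !inE eqxx ?orbT.
have [||{}q] := @exists_missed_block [:: [:: z u]; [:: w u]] Y'.
- by rewrite /= inE zw.
- by rewrite cY'.
by rewrite !inE => /orP[]/eqP->; rewrite /= andbT => tY';
  [apply: (wins_from_two_cells 1 (copyz u uus))
  |apply: (wins_from_two_cells 1 (copyw u uus))]; rewrite // inE negb_or;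
  apply/andP; split.
Qed.

(** Here [c] is the end of an arm and [c + u] is the corner. With [c] as corner, the missing pairs
    of consecutive directions would overlap; now each pair has its own edge neighbour and its own
    diagonal neighbour of [c]. *)
Lemma L_copy_from_arm (c u : cell) : u.1 ^+ 2 + u.2 ^+ 2 = 1 ->
  congruent P32 [fset c; (c.1 + u.1, c.2 + u.2);
                 (c.1 + u.1 - u.2, c.2 + u.2 + u.1)].
Proof.
move=> u1.
(* The direction is [u] turned by a quarter; one more quarter turn gives [- u], which leads from the
   corner back to [c]. *)
have := @L_copy (c.1 + u.1, c.2 + u.2) (- u.2, u.1).
rewrite /= sqrrN addrC => /(_ u1); congr congruent.
rewrite fsetUC fsetUA; have -> : (c.1 + u.1 - u.1, c.2 + u.2 - u.2) = c.
  by rewrite !addrK; case: c.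
by [].
Qed.

Lemma straight_winner_1_1 : winner 1 1 P31.
Proof.
have unit (u : cell) : u \in [:: (1, 0); (0, 1)] -> u.1 ^+ 2 + u.2 ^+ 2 = 1.
  by rewrite !inE => /orP[]/eqP->.
(* The pair [0], [u] is extended at either end; the two axes meet only in the origin. *)
apply: (@winner_1_1 _ [:: (1, 0); (0, 1)] id
  (fun u => (2 * u.1, 2 * u.2)) (fun u => (- u.1, - u.2))) => // u.
- move=> /unit /(straight_copy (0, 0)).
  by rewrite /= !add0r -surjective_pairing.
- move=> /unit /(straight_copy (- u.1, - u.2)).
  have dbl (i : int) : - i + 2 * i = i by ring.
  rewrite /= !addNr !dbl -surjective_pairing.
  by rewrite fsetUC fsetUA fsetUAC [[fset u] `|` _]fsetUC.
- by rewrite !inE => /orP[]/eqP->.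
Qed.

Lemma L_winner_1_1 : winner 1 1 P32.
Proof.
have unit (u : cell) : u \in [:: (1, 0); (-1, 0)] -> u.1 ^+ 2 + u.2 ^+ 2 = 1.
  by rewrite !inE => /orP[]/eqP->.
(* Any third cell of a 2 by 2 square completes a domino in it to an L. The two directions use
   diagonally opposite squares at the origin. *)
apply: (@winner_1_1 _ [:: (1, 0); (-1, 0)] id
  (fun u => (- u.2, u.1)) (fun u => (u.1 - u.2, u.2 + u.1))) => // u.
- move=> /unit /(L_copy (0, 0)).
  by rewrite /= !add0r -surjective_pairing.
- move=> /unit /(L_copy_from_arm (0, 0)).
  by rewrite /= !add0r -surjective_pairing.
- by rewrite !inE => /orP[]/eqP->.
Qed.

Lemma straight_winner_2_7 : winner 2 7 P31.
Proof.
apply: (@winner_2_7 _ (fun c u => (c.1 + u.1, c.2 + u.2))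
  (fun c u => (c.1 + 2 * u.1, c.2 + 2 * u.2))) => // c u /directions_unit.
exact: straight_copy.
Qed.

Lemma L_winner_2_7 : winner 2 7 P32.
Proof.
apply: (@winner_2_7 _ (fun c u => (c.1 + u.1, c.2 + u.2))
  (fun c u => (c.1 + u.1 - u.2, c.2 + u.2 + u.1))) => // c u /directions_unit.
exact: L_copy_from_arm.
Qed.

Lemma tromino_winner_3 (A : polyomino) (n b : nat) :
  A = P31 \/ A = P32 -> (3 <= n)%N -> winner n b A.
Proof.
move=> AP n3; apply: (@winner_of_wins _ _ 1).
apply: (@wins_last_move _ _ _ A); last exact: fdisjointX0.
  exists id => //; rewrite imfset_id //.
rewrite fsetD0; apply: leq_trans n3.
by case: AP => ->; rewrite /= card_fset3.
Qed.

End Trominoes.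

Theorem theorem7p2 :
  is_threshold_sequence P31 (then_infinite [:: 1; 7]) /\
  is_threshold_sequence P32 (then_infinite [:: 1; 7]) /\
  (forall A : polyomino, A = P31 \/ A = P32 ->
    winner 1 1 A /\ loser 1 2 A /\ winner 2 7 A /\ loser 2 8 A /\
    (forall n b : nat, 3 <= n -> winner n b A)).
Proof.
have L1 A b : A = P31 \/ A = P32 -> 1 < b -> loser 1 b A.
  by case=> ->; [exact: straight_loser_1|exact: L_loser_1].
have W1 A : A = P31 \/ A = P32 -> winner 1 1 A.
  by case=> ->; [exact: straight_winner_1_1|exact: L_winner_1_1].
have W2 A : A = P31 \/ A = P32 -> winner 2 7 A.
  by case=> ->; [exact: straight_winner_2_7|exact: L_winner_2_7].
have thr A : A = P31 \/ A = P32 ->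
    is_threshold_sequence A (then_infinite [:: 1; 7]).
  move=> AP [|[|[|n]]] //= _.
  - split=> [|b wb]; first exact: W1.
    by rewrite leqNgt; apply/negP => /(L1 _ _ AP).
  - split=> [|b wb]; first exact: W2.
    by rewrite leqNgt; apply/negP => /(tromino_loser_2 AP).
  (* From index 3 on the list is exhausted and [nth] returns its default [Infinite]. *)
  - by rewrite /then_infinite /= nth_nil => b; apply: tromino_winner_3.
split; first by apply: thr; left.
split; first by apply: thr; right.
move=> A AP; split; first exact: W1.
split; first exact: L1.
split; first exact: W2.
split; first exact: tromino_loser_2.
by move=> n b; apply: tromino_winner_3.
Qed.
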